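(* Let $d, I_1, I_2$ be positive integers. In Game 1, Player A and Player B start with $I_1$ and $I_2$ M\&M's, respectively. In each round, each player tosses one fair coin (all tosses being independent), and a player eats $d$ M\&M's (or all her remaining M\&M's, if fewer than $d$ remain) if that player's coin lands heads and eats none if it lands tails. Let $\mathbb{P}_{(d)}^{(1)}(I_1,I_2)$ denote the probability that Game 1 ends in a tie. Then $$\mathbb{P}_{(d)}^{(1)}(I_1, I_2) = \frac{1}{3}\,D\left(\left\lfloor \frac{I_1 - 1}{d} \right\rfloor, \left\lfloor \frac{I_2 - 1}{d} \right\rfloor, \frac{1}{3} \right).$$
   Context: The game is played in rounds until, at the end of some round, at least one player has no M\&M's remaining. The game ends in a tie if both players run out of M\&M's in the same round; if exactly one player has M\&M's remaining, that player wins. If a player is ever supposed to eat more M\&M's than she has left, she eats all her remaining M\&M's. For integers $m,n\ge 0$ and a real number $t$, the (weighted) Delannoy number is $$D(m,n,t)=\sum_{\ell=0}^{\min(m,n)} \binom{m+n-\ell}{m-\ell,\;n-\ell,\;\ell}\, t^{\,m+n-\ell},$$ where $\binom{a+b+c}{a,b,c}=\frac{(a+b+c)!}{a!\,b!\,c!}$ is the multinomial coefficient. *)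

(* Defs.v *)
From HB Require Import structures.
From mathcomp Require Export all_boot all_order all_algebra.
From mathcomp Require Export all_classical all_reals all_analysis.

Set Implicit Arguments.
Unset Strict Implicit.
Unset Printing Implicit Defensive.

Import Order.TTheory GRing.Theory Num.Theory.

Local Open Scope classical_set_scope.
Local Open Scope ring_scope.

Section Independence.
Context {disp disp' : measure_display} {T : measurableType disp}
  {T' : measurableType disp'} {R : realType} (P : probability T R).

(* Product rule over every finite subfamily, listed without repetition. *)
Definition mutually_independent (I : eqType) (X : I -> {RV P >-> T'}) : Prop :=
  forall (s : seq I) (B : I -> set T'),
    uniq s -> (forall i, measurable (B i)) ->
    P (\bigcap_(i in [set` s]) (X i @^-1` B i)) =
    (\prod_(i <- s) P (X i @^-1` B i))%E.
End Independence.

Section Coins.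
Context {disp : measure_display} {T : measurableType disp} {R : realType}
  (P : probability T R).

(* Heads is [true]. *)
Definition fair_coin (X : {RV P >-> bool}) : Prop :=
  P (X @^-1` [set true]) = (2^-1)%:E.

(* The tosses of both players, as one family: [inl k] is the toss of Player A
   in round k, [inr k] that of Player B; rounds are numbered from 0. *)
Definition all_tosses (A B : nat -> {RV P >-> bool}) (i : nat + nat) :
  {RV P >-> bool} :=
  match i with inl k => A k | inr k => B k end.
End Coins.

(* Pairs (M&M's of Player A, M&M's of Player B). *)
Definition game_over (s : nat * nat) : bool := (s.1 == 0)%N || (s.2 == 0)%N.

(* Truncated subtraction: a player having fewer than d left eats them all. *)
Definition eat (d : nat) (heads : bool) (x : nat) : nat :=
  if heads then (x - d)%N else x.

Definition game1_round (d : nat) (a b : bool) (s : nat * nat) : nat * nat :=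
  if game_over s then s else (eat d a s.1, eat d b s.2).

(* Position after n rounds, for the toss sequences a and b. *)
Fixpoint game1 (d I1 I2 : nat) (a b : nat -> bool) (n : nat) : nat * nat :=
  if n is k.+1 then game1_round d (a k) (b k) (game1 d I1 I2 a b k)
  else (I1, I2).

Definition game1_tie (d I1 I2 : nat) (a b : nat -> bool) : Prop :=
  exists n : nat,
    ~~ game_over (game1 d I1 I2 a b n) /\
    game1 d I1 I2 a b n.+1 = (0, 0)%N.

Section Delannoy.
Context {R : realType}.

Definition trinomial (a b c : nat) : R :=
  ((a + b + c)`!)%:R / (a`! * b`! * c`!)%:R.

Definition delannoy (m n : nat) (t : R) : R :=
  \sum_(l < (minn m n).+1)
    trinomial (m - l) (n - l) l * t ^+ (m + n - l).
End Delannoy.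

(* Main.v *)
(** The stocks matter only through the numbers i, j of heads that
    the two players still need. Conditioning on the first round that is not (tails, tails),
    the tie probability p satisfies
    3 p(i, j) = p(i-1, j-1) + p(i-1, j) + p(i, j-1), with p(0, 0) = 1 and
    p(i, 0) = p(0, j) = 0 otherwise. This is the recurrence of the Delannoy
    numbers at t = 1/3, shifted by one in both indices. To avoid stationarity of
    the infinite toss sequence, the recurrence is run on the probability of a tie
    within n rounds, and p is obtained as the monotone limit in n. *)
Require Import Defs.
From mathcomp Require Import all_boot all_order all_algebra.
From mathcomp Require Import ring lra zify.
From mathcomp Require Import all_classical all_reals all_analysis.
Import Order.TTheory GRing.Theory Num.Theory.
Import numFieldNormedType.Exports.

Local Open Scope classical_set_scope.
Local Open Scope ring_scope.

(** * Weighted Delannoy numbers: boundary values and recurrence *)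

Section WeightedDelannoy.
Context {R : realType}.
Implicit Types (m n l : nat) (t : R).

(* The right-hand side vanishes for l > min(m, n), so that the range of the sum
   defining the Delannoy number can be enlarged freely. *)
Lemma trinomial_bin m n l : (l <= minn m n)%N ->
  trinomial (m - l) (n - l) l = ('C(m, l) * 'C(m + n - l, m))%:R :> R.
Proof.
rewrite leq_min => /andP[lm ln]; rewrite /trinomial.
have -> : (m - l + (n - l) + l = m + n - l)%N by lia.
have fac_neq0 k : (k`!%:R != 0 :> R) by rewrite pnatr_eq0 -lt0n fact_gt0.
apply: (@mulIf _ ((m - l)`! * (n - l)`! * l`!)%:R).
  by rewrite !natrM !mulf_neq0.
rewrite mulfVK; last by rewrite !natrM !mulf_neq0.
rewrite -natrM; congr (_%:R).
have /bin_fact <- : (m <= m + n - l)%N by lia.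
have -> : (m + n - l - m = n - l)%N by lia.
by rewrite -(bin_fact lm); lia.
Qed.

Lemma delannoy_bin K m n t : (m < K)%N ->
  delannoy m n t =
  \sum_(l < K) ('C(m, l) * 'C(m + n - l, m))%:R * t ^+ (m + n - l).
Proof.
move=> mK; rewrite /delannoy.
have le_minK : ((minn m n).+1 <= K)%N by lia.
rewrite (big_ord_widen K (fun l => trinomial (m - l) (n - l) l * t ^+ (m + n - l))
  le_minK) big_mkcond /=.
apply: eq_bigr => l _; case: ifP => [l_le|/negbT l_gt].
  by rewrite trinomial_bin.
have [lm|ml] := leqP l m; last by rewrite bin_small // mul0n mul0r.
by rewrite ['C(m + n - l, m)]bin_small ?muln0 ?mul0r //; lia.
Qed.

Lemma delannoy0n n t : delannoy 0 n t = t ^+ n.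
Proof. by rewrite (@delannoy_bin 1) // big_ord1 !bin0 mul1r subn0. Qed.

Lemma delannoyn0 m t : delannoy m 0 t = t ^+ m.
Proof.
by rewrite /delannoy minn0 big_ord1 trinomial_bin // subn0 addn0 bin0 binn mul1r.
Qed.

(** Pascal's rule, applied to both binomial factors, splits each term into three. The [delannoy m n]
    part appears with its index shifted by one, so the terms at l = 0 are treated apart in
    [head]. *)
Lemma delannoyS m n t :
  delannoy m.+1 n.+1 t =
  t * (delannoy m n.+1 t + delannoy m.+1 n t + delannoy m n t).
Proof.
(* The bounds are chosen so that, once the l = 0 terms are split off, all four sums have [m.+1]
   terms. *)
rewrite (@delannoy_bin m.+2 m.+1) // (@delannoy_bin m.+2 m n.+1) //.
rewrite (@delannoy_bin m.+2 m.+1 n) // (@delannoy_bin m.+1 m n) //.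
rewrite !(big_ord_recl m.+1) /= !subn0 !bin0 !mul1n.
have pascal l : (l <= m)%N ->
    ('C(m.+1, l.+1) * 'C(m.+1 + n.+1 - l.+1, m.+1) =
     'C(m, l.+1) * 'C(m + n.+1 - l.+1, m) +
     'C(m.+1, l.+1) * 'C(m.+1 + n - l.+1, m.+1) +
     'C(m, l) * 'C(m + n - l, m))%N.
  move=> lm.
  have -> : (m.+1 + n.+1 - l.+1 = (m + n - l).+1)%N by lia.
  have -> : (m + n.+1 - l.+1 = m + n - l)%N by lia.
  have -> : (m.+1 + n - l.+1 = m + n - l)%N by lia.
  by rewrite (binS m l) (binS (m + n - l) m) !mulnDl !mulnDr; lia.
have head : 'C(m.+1 + n.+1, m.+1)%:R * t ^+ (m.+1 + n.+1) =
    t * ('C(m + n.+1, m)%:R * t ^+ (m + n.+1)) +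
    t * ('C(m.+1 + n, m.+1)%:R * t ^+ (m.+1 + n)) :> R.
  rewrite addSn binS natrD addnS -addSn exprS; ring.
rewrite head !mulrDr -!addrA; congr (_ + _).
rewrite addrCA; congr (_ + _).
rewrite !mulr_sumr -!big_split /=; apply: eq_bigr => i _.
rewrite /bump /= !add1n (pascal i (ltn_ord i)).
have -> : (m.+1 + n.+1 - i.+1 = (m + n - i).+1)%N by have := ltn_ord i; lia.
have -> : (m + n.+1 - i.+1 = m + n - i)%N by lia.
have -> : (m.+1 + n - i.+1 = m + n - i)%N by lia.
rewrite exprS !natrD; ring.
Qed.
End WeightedDelannoy.

(** * The probability of a tie within n rounds and its limit *)

Section TieProbability.
Context {R : realType}.
Variables (d : nat).
Implicit Types (n : nat) (s : nat * nat).

(** Averages over the first round, purely arithmetically; [prob_tied] later identifies it with a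
    probability. *)
Fixpoint tie_by n s : R :=
  if n is k.+1 then
    4^-1 * \sum_(c : bool * bool) tie_by k (game1_round d c.1 c.2 s)
  else (s == (0, 0)%N)%:R.

Lemma sum_bool2 (V : nmodType) (F : bool * bool -> V) :
  \sum_c F c = F (true, true) + F (true, false) + F (false, true) + F (false, false).
Proof.
rewrite (eq_bigr (fun c => F (c.1, c.2))) => [|[] //].
by rewrite -(pair_bigA _ (fun a b => F (a, b))) /= !big_bool /= addrA.
Qed.

Lemma tie_by_ge0 n s : 0 <= tie_by n s.
Proof.
elim: n s => [|n IHn] s /=; first exact: ler0n.
by rewrite mulr_ge0 ?invr_ge0 ?ler0n ?sumr_ge0.
Qed.

Lemma tie_by_le1 n s : tie_by n s <= 1.
Proof.
elim: n s => [|n IHn] s /=; first by case: eqP.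
rewrite sum_bool2.
have := IHn (game1_round d true true s).
have := IHn (game1_round d true false s).
have := IHn (game1_round d false true s).
have := IHn (game1_round d false false s).
lra.
Qed.

Lemma tie_by_over n s : game_over s -> tie_by n s = (s == (0, 0)%N)%:R.
Proof.
move=> s_over; elim: n => //= n IHn.
by rewrite /game1_round s_over sum_bool2 IHn; lra.
Qed.

Lemma tie_by_nondecreasing s : nondecreasing_seq (tie_by ^~ s).
Proof.
apply/nondecreasing_seqP => n; elim: n s => [|n IHn] s.
  have [->|/negbTE s_neq0] := eqVneq s (0, 0)%N; first by rewrite !tie_by_over.
  by rewrite [X in X <= _]/= s_neq0 tie_by_ge0.
change (tie_by n.+1 s <=
  4^-1 * \sum_(c : bool * bool) tie_by n.+1 (game1_round d c.1 c.2 s)).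
by rewrite [tie_by n.+1 s]/= ler_wpM2l ?invr_ge0 ?ler0n // ler_sum.
Qed.

(* i and j count the heads that the players still need to have eaten everything. *)
Definition tie_limit (i j : nat) : R :=
  match i, j with
  | 0, 0 => 1
  | m.+1, n.+1 => 3^-1 * delannoy m n 3^-1
  | _, _ => 0
  end.

(** The values of [tie_limit] on the axes are set so that the Delannoy recurrence at 1/3 also covers
    i = 0 or j = 0. *)
Lemma tie_limitS i j :
  tie_limit i.+1 j.+1 =
  3^-1 * (tie_limit i j + tie_limit i j.+1 + tie_limit i.+1 j).
Proof.
case: i j => [|i] [|j]; rewrite /tie_limit.
- by rewrite delannoy0n expr0; lra.
- by rewrite !delannoy0n exprS; lra.
- by rewrite !delannoyn0 exprS; lra.
- by rewrite delannoyS; lra.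
Qed.

Hypothesis d_gt0 : (0 < d)%N.

(** The ceiling of x / d. *)
Definition heads_left (x : nat) : nat := (x + d.-1) %/ d.

Lemma heads_left0 : heads_left 0 = 0%N.
Proof. by rewrite /heads_left divn_small // add0n; lia. Qed.

Lemma heads_left_gt0 x : (0 < x)%N -> heads_left x = ((x - 1) %/ d).+1.
Proof.
move=> x_gt0; rewrite /heads_left.
have -> : (x + d.-1 = x - 1 + d)%N by lia.
by rewrite divnDr ?dvdnn // divnn d_gt0 addn1.
Qed.

Lemma heads_leftB x : heads_left (x - d) = (heads_left x).-1.
Proof.
case: (posnP x) => [->|x_gt0]; first by rewrite sub0n heads_left0.
rewrite (heads_left_gt0 _ x_gt0) /= /heads_left.
have [dx|xd] := leqP d x; first by congr (_ %/ _)%N; lia.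
by rewrite !divn_small //; lia.
Qed.

Lemma tie_by_cvg s :
  tie_by ^~ s @ \oo --> tie_limit (heads_left s.1) (heads_left s.2).
Proof.
(* Any head tossed in an unfinished game lowers the total stock. *)
move eN : (s.1 + s.2)%N => N; elim/ltn_ind: N s eN => N IHN s sN.
have [s_over|s_going] := boolP (game_over s).
  rewrite (_ : tie_by ^~ s = fun=> (s == (0, 0)%N)%:R); last first.
    by apply/funext => n; rewrite tie_by_over.
  rewrite (_ : tie_limit _ _ = (s == (0, 0)%N)%:R); first exact: cvg_cst.
  case: s s_over {sN IHN} => x y; rewrite /game_over xpair_eqE /=.
  case: (posnP x) => [->|x_gt0]; case: (posnP y) => [->|y_gt0] //= _;
    by rewrite ?heads_left0 ?heads_left_gt0.
have /andP[x_gt0 y_gt0] : (0 < s.1)%N && (0 < s.2)%N.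
  by move: s_going; rewrite /game_over negb_or !lt0n.
(* Two tails lead back to s, out of reach of the induction; so the limit l at s is first obtained
   from monotonicity and boundedness, then computed. *)
pose l : R := lim (tie_by ^~ s @ \oo).
have cvg_s : tie_by ^~ s @ \oo --> l.
  apply: nondecreasing_is_cvgn; first exact: tie_by_nondecreasing.
  by exists 1 => _ [n _ <-]; exact: tie_by_le1.
have cvg_round c : c != (false, false) ->
    tie_by ^~ (game1_round d c.1 c.2 s) @ \oo -->
    tie_limit (heads_left (eat d c.1 s.1)) (heads_left (eat d c.2 s.2)).
  move=> c_heads; rewrite /game1_round (negbTE s_going).
  apply: (IHN (eat d c.1 s.1 + eat d c.2 s.2)%N) => //=.
  by case: c c_heads => -[] [] //= _; rewrite -sN; lia.
have tails : game1_round d false false s = s.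
  by rewrite /game1_round (negbTE s_going) /=; case: (s).
have l_unique x : (fun n => tie_by n.+1 s) @ \oo --> x -> x = l.
  move=> cvg_x; apply: (cvg_unique _ cvg_x); first exact: norm_hausdorff.
  by move: cvg_s; rewrite -(cvg_shiftS (tie_by ^~ s)).
have cvg_s1 : (fun n => tie_by n.+1 s) @ \oo --> 4^-1 *
    (tie_limit (heads_left s.1).-1 (heads_left s.2).-1 +
     tie_limit (heads_left s.1).-1 (heads_left s.2) +
     tie_limit (heads_left s.1) (heads_left s.2).-1 + l).
  rewrite (_ : (fun n => _) = fun n => 4^-1 *
     (tie_by n (game1_round d true true s) + tie_by n (game1_round d true false s)
      + tie_by n (game1_round d false true s) + tie_by n s)); last first.
    by apply/funext => n /=; rewrite sum_bool2 /= tails.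
  rewrite -!heads_leftB; apply: cvgMl_tmp; apply: cvgD => //; apply: cvgD.
    by apply: cvgD; [exact: (cvg_round (true, true))|exact: (cvg_round (true, false))].
  exact: (cvg_round (false, true)).
suff -> : tie_limit (heads_left s.1) (heads_left s.2) = l by [].
(* The equation l = (S + l) / 4 gives l = S / 3, where S is the bracket in [tie_limitS]. *)
have := l_unique _ cvg_s1.
rewrite (heads_left_gt0 _ x_gt0) (heads_left_gt0 _ y_gt0).
by rewrite tie_limitS !succnK; lra.
Qed.

End TieProbability.

(** * The game on the probability space *)

(** [game1] adds rounds at the end, whereas [tie_by] removes the first one. *)
Lemma game1S d s a b n :
  game1 d s.1 s.2 a b n.+1 =
  game1 d (game1_round d (a 0%N) (b 0%N) s).1 (game1_round d (a 0%N) (b 0%N) s).2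
    (a \o S) (b \o S) n.
Proof.
elim: n => [|n IHn]; first by rewrite /= -!surjective_pairing.
by rewrite -[LHS]/(game1_round d (a n.+1) (b n.+1) (game1 d s.1 s.2 a b n.+1)) IHn.
Qed.

Section TieEvent.
Context {R : realType} {disp : measure_display} {T : measurableType disp}
  (P : probability T R).
Variables (A B : nat -> {RV P >-> bool}) (d : nat).
Hypotheses (fairA : forall k, fair_coin (A k)) (fairB : forall k, fair_coin (B k)).
Hypothesis indepAB : mutually_independent (all_tosses A B).
Implicit Types (j n : nat) (s : nat * nat) (c : bool * bool) (u : nat -> bool * bool).

Definition round_event j c : set T := A j @^-1` [set c.1] `&` B j @^-1` [set c.2].

Definition prefix_event j u : set T := \bigcap_(k in `I_j) round_event k (u k).

(** The game is started from s at round j, so that only tosses from round j on matter. *)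
Definition tied_event j n s : set T :=
  [set w | game1 d s.1 s.2 (fun k => A (j + k)%N w) (fun k => B (j + k)%N w) n
           = (0, 0)%N].

Lemma measurable_toss (X : {RV P >-> bool}) x : measurable (X @^-1` [set x]).
Proof. exact: measurable_funPTI. Qed.

Lemma fair_coinE (X : {RV P >-> bool}) x :
  fair_coin X -> P (X @^-1` [set x]) = (2^-1)%:E.
Proof.
case: x => // fairX.
rewrite (_ : _ @^-1` _ = ~` (X @^-1` [set true])); last first.
  by apply/seteqP; split => w /=; case: (X w).
rewrite probability_setC; last exact: measurable_toss.
by rewrite fairX -EFinB; congr _%:E; lra.
Qed.

Lemma measurable_round j c : measurable (round_event j c).
Proof. by apply: measurableI; exact: measurable_toss. Qed.

Lemma measurable_prefix j u : measurable (prefix_event j u).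
Proof. by apply: bigcap_measurableType => k _; exact: measurable_round. Qed.

Lemma tied_event0 j s : tied_event j 0 s = if s == (0, 0)%N then setT else set0.
Proof.
by apply/seteqP; split => w; rewrite /tied_event /= -surjective_pairing;
  case: eqP.
Qed.

Lemma tied_eventS j n s c :
  tied_event j n.+1 s `&` round_event j c =
  tied_event j.+1 n (game1_round d c.1 c.2 s) `&` round_event j c.
Proof.
have shift (X : nat -> {RV P >-> bool}) w :
    (fun k => X (j + k)%N w) \o S = fun k => X (j.+1 + k)%N w.
  by apply/funext => k /=; rewrite addnS.
by apply/seteqP; split => w [tied] /[dup] jc [/= Ac Bc]; split=> //;
  move: tied; rewrite /tied_event /mkset game1S !shift addn0 Ac Bc.
Qed.

Lemma measurable_tied j n s : measurable (tied_event j n s).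
Proof.
elim: n j s => [|n IHn] j s.
  by rewrite tied_event0; case: ifP => _; [exact: measurableT|exact: measurable0].
rewrite (_ : tied_event j n.+1 s =
    \bigcup_(c in [set: bool * bool]) (tied_event j n.+1 s `&` round_event j c)).
  apply: fin_bigcup_measurable => [|c _]; first exact: finite_finset.
  by rewrite tied_eventS; apply: measurableI; [exact: IHn|exact: measurable_round].
apply/seteqP; split => w; last by case=> c _ [].
by exists (A j w, B j w).
Qed.

Lemma prob_prefix j u : P (prefix_event j u) = (4^-1 ^+ j)%:E.
Proof.
(* The 2j tosses of both players form one finite subfamily, to which joint independence applies. *)
pose I : seq (nat + nat) := [seq inl k | k <- iota 0 j] ++ [seq inr k | k <- iota 0 j].
pose C (i : nat + nat) : set bool :=
  match i with inl k => [set (u k).1] | inr k => [set (u k).2] end.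
have uniqI : uniq I.
  rewrite cat_uniq !map_inj_uniq ?iota_uniq //=; try by move=> x y [].
  by rewrite andbT; apply/hasPn => _ /mapP[k _ ->]; apply/mapP => -[].
rewrite (_ : prefix_event j u = \bigcap_(i in [set` I]) (all_tosses A B i @^-1` C i)).
  rewrite indepAB //.
  rewrite (eq_bigr (fun=> (2^-1)%:E)); last first.
    by case=> k _; [exact: (fair_coinE _ _ (fairA k))|exact: (fair_coinE _ _ (fairB k))].
  rewrite big_cat !big_map !prodEFin /= !big_const_seq !count_predT !size_iota.
  rewrite !iter_mulr_1 -EFinM -exprMn; congr (_ ^+ _)%:E; lra.
apply/seteqP; split => w.
  move=> pre [k|k] /=; rewrite mem_cat => /orP[] /mapP[l + []] // ->;
    by rewrite mem_iota => /pre[].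
move=> pre k kj; split; [apply: (pre (inl k))|apply: (pre (inr k))];
  rewrite /= mem_cat; apply/orP; [left|right]; apply: map_f; by rewrite mem_iota.
Qed.

Lemma prob_toss_split (X : {RV P >-> bool}) (D : set T) : measurable D ->
  P D = (P (D `&` X @^-1` [set true]) + P (D `&` X @^-1` [set false]))%E.
Proof.
move=> mD; rewrite (measureDI _ mD (measurable_toss X true)) addeC.
congr (_ + P _)%E; apply/seteqP; split => w /= [Dw];
  by case: (X w); split.
Qed.

Lemma prob_round_split j (D : set T) : measurable D ->
  P D = (\sum_c P (D `&` round_event j c))%E.
Proof.
move=> mD; rewrite sum_bool2 (prob_toss_split (A j)) //.
have mDA x : measurable (D `&` A j @^-1` [set x]).
  exact: measurableI mD (measurable_toss _ _).
rewrite (prob_toss_split (B j) _ (mDA true)) (prob_toss_split (B j) _ (mDA false)).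
by rewrite /round_event !setIA addeA.
Qed.

(** A Markov property without conditional probabilities: with the past fully prescribed, splitting
    on round j only lengthens the prefix, and independence is needed for prefixes alone. *)
Lemma prob_tied j n s u :
  P (prefix_event j u `&` tied_event j n s) = (4^-1 ^+ j * tie_by d n s)%:E.
Proof.
elim: n j s u => [|n IHn] j s u.
  rewrite tied_event0 /=; case: ifP => _; first by rewrite setIT prob_prefix mulr1.
  by rewrite setI0 measure0 mulr0.
rewrite (prob_round_split j); last first.
  by apply: measurableI; [exact: measurable_prefix|exact: measurable_tied].
rewrite [tie_by d n.+1 s]/= mulrA -exprSr mulr_sumr -sumEFin.
(* [u'] extends the prescribed past by the outcome c of round j. *)
apply: eq_bigr => c _; pose u' k := if k == j then c else u k.
rewrite -(IHn _ _ u') -setIA tied_eventS setIA setIAC; congr (P (_ `&` _)).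
apply/seteqP; split => w.
  move=> [pre jc] k; rewrite /= ltnS leq_eqVlt /u' => /orP[/eqP ->|kj]; first by rewrite eqxx.
  by rewrite ltn_eqF //; exact: pre.
move=> pre; split=> [k kj|]; last by have := pre j (ltnSn j); rewrite /u' eqxx.
by have := pre k (ltnW kj); rewrite /u' ltn_eqF.
Qed.

End TieEvent.

(** * Ties as an increasing union of events *)

Lemma game1_over d x y a b k n : (k <= n)%N -> game_over (game1 d x y a b k) ->
  game1 d x y a b n = game1 d x y a b k.
Proof.
move=> kn over_k; elim: n kn => [|n IHn]; first by rewrite leqn0 => /eqP ->.
rewrite leq_eqVlt => /orP[/eqP -> //|]; rewrite ltnS => kn.
by rewrite /= IHn // /game1_round over_k.
Qed.

(** Finished positions are frozen and the start is not (0, 0), so the first arrival at (0, 0) comes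
    from an unfinished position. *)
Lemma game1_tieP d x y a b : (0 < x)%N ->
  game1_tie d x y a b <-> exists n, game1 d x y a b n = (0, 0)%N.
Proof.
move=> x_gt0; split=> [[n [_ tie_n]]|[n]]; first by exists n.+1.
elim: n => [[x0 _]|n IHn tie_n]; first by rewrite x0 in x_gt0.
have [over_n|going] := boolP (game_over (game1 d x y a b n)); last by exists n.
by apply: IHn; rewrite -tie_n (game1_over _ _ _ _ _ _ _ (leqnSn n)).
Qed.

Theorem theorem2p3 (R : realType) (disp : measure_display)
    (T : measurableType disp) (P : probability T R)
    (A B : nat -> {RV P >-> bool}) (d I1 I2 : nat)
    (fairA : forall k, fair_coin (A k)) (fairB : forall k, fair_coin (B k))
    (indepAB : mutually_independent (all_tosses A B))
    (d_gt0 : (0 < d)%N) (I1_gt0 : (0 < I1)%N) (I2_gt0 : (0 < I2)%N) :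
  P [set w | game1_tie d I1 I2 (fun k => A k w) (fun k => B k w)] =
  (3^-1 * delannoy ((I1 - 1) %/ d) ((I2 - 1) %/ d) 3^-1)%:E.
Proof.
rewrite (_ : [set w | _] = \bigcup_n tied_event P A B d 0 n (I1, I2)); last first.
  by apply/seteqP; split => w; rewrite /= game1_tieP // => -[n]; exists n.
have tied_prob n : P (tied_event P A B d 0 n (I1, I2)) = (tie_by d n (I1, I2))%:E.
  (* The prefix of length 0 is the whole space, whatever outcomes are prescribed. *)
  have <- : prefix_event P A B 0 (fun=> (true, true)) `&` tied_event P A B d 0 n (I1, I2)
      = tied_event P A B d 0 n (I1, I2) by apply/setIidr => w _ k.
  by rewrite prob_tied // mul1r.
have mtied n : measurable (tied_event P A B d 0 n (I1, I2)) by exact: measurable_tied.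
have : P \o (fun n => tied_event P A B d 0 n (I1, I2)) @ \oo -->
    P (\bigcup_n tied_event P A B d 0 n (I1, I2)).
  apply: nondecreasing_cvg_mu => //; first exact: bigcupT_measurable.
  move=> m n mn; apply/subsetPset => w; rewrite /tied_event /= => tie_m.
  by rewrite (game1_over _ _ _ _ _ m) // tie_m.
(* Continuity from below gives one limit of the probabilities; [tie_by_cvg] gives the other. *)
move/cvg_unique; apply; first exact: ereal_hausdorff.
rewrite (_ : P \o _ = EFin \o (fun n => tie_by d n (I1, I2))); last first.
  by apply/funext => n; exact: tied_prob.
apply: cvg_EFin; first exact: nearW.
have := tie_by_cvg d d_gt0 (I1, I2).
by rewrite /= !heads_left_gt0.
Qed.
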